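(* Let $m,n\ge 2$. The QR-ratio $$R(m,n)=\sup\left\{\frac{Q(\Psi)}{Z(\Psi)}:\Psi\in S(m,n)\setminus\{\mathcal{O}\}\right\}$$ is a finite positive number. Actually, $$1\le R(m,n)\le\frac{2^{\frac{m-1}{2}}\,\rho(m,2n)}{\mu(m,n)}.$$
   Context: $S(m,n)$ is the space of $m$-order $n$-dimensional real symmetric tensors $\mathcal{T}=(\mathcal{T}_{i_1\cdots i_m})$, $i_1,\dots,i_m\in\{1,\dots,n\}$ (symmetric: entries invariant under any permutation of the indices), and $\mathcal{O}$ is the zero tensor. For $z\in\mathbb{C}^n$, $\mathcal{T}z^{m-1}\in\mathbb{C}^n$ is the vector with $i$th component $(\mathcal{T}z^{m-1})_i=\sum_{i_2,\dots,i_m=1}^n\mathcal{T}_{ii_2\cdots i_m}z_{i_2}\cdots z_{i_m}$. The Frobenius norm is $\|\mathcal{T}\|=\sqrt{\sum_{i_1,\dots,i_m=1}^n\mathcal{T}_{i_1\cdots i_m}^2}$. A bar denotes complex conjugation. Z-eigenvalue: a real number $\lambda$ is a Z-eigenvalue of $\mathcal{T}\in S(m,n)$ with Z-eigenvector $w\in\mathbb{R}^n$ if $\mathcal{T}w^{m-1}=\lambda w$ and $w^\top w=1$. Z-eigenvalues of a real symmetric tensor always exist; the Z-spectral radius $Z(\mathcal{T})$ is the largest absolute value of the Z-eigenvalues of $\mathcal{T}$. It is known that $Z(\cdot)$ is a norm on $S(m,n)$, so that $$\rho(m,n):=\sup\left\{\frac{Z(\mathcal{T})}{\|\mathcal{T}\|}:\mathcal{T}\in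 S(m,n)\setminus\{\mathcal{O}\}\right\},\qquad \mu(m,n):=\inf\left\{\frac{Z(\mathcal{T})}{\|\mathcal{T}\|}:\mathcal{T}\in S(m,n)\setminus\{\mathcal{O}\}\right\}$$ are finite positive numbers. Q-eigenvalue (quantum eigenvalue): for $\Psi\in S(m,n)$, a real number $\lambda$ is a Q-eigenvalue of $\Psi$ with Q-eigenvector $z\in\mathbb{C}^n$ if $\Psi z^{m-1}=\lambda\bar z$ and $\bar z^\top z=1$. Q-eigenvalues always exist; the largest Q-eigenvalue of $\Psi$ is called the entanglement eigenvalue of $\Psi$ and is denoted $Q(\Psi)$. *)

(* Defs.v *)
From mathcomp Require Import all_boot all_order all_algebra all_fingroup.
From mathcomp Require Import complex.
From mathcomp Require Import classical_sets reals exp.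

Set Implicit Arguments.
Unset Strict Implicit.
Unset Printing Implicit Defensive.

Import Order.TTheory GRing.Theory Num.Theory.

Local Open Scope classical_set_scope.
Local Open Scope complex_scope.
Local Open Scope ring_scope.

Definition tensor (K : Type) (m n : nat) := {ffun m.-tuple 'I_n -> K}.

Definition tensor_sym (K : Type) (m n : nat) : set (tensor K m n) :=
  [set T : tensor K m n | forall (s : 'S_m) (t : m.-tuple 'I_n),
             T [tuple tnth t (s j) | j < m] = T t].
Arguments tensor_sym : clear implicits.

Definition tensor0 (K : nmodType) (m n : nat) : tensor K m n := [ffun=> 0].
Arguments tensor0 : clear implicits.

(* T z^(m-1): for m >= 1 the sum ranges over the index tuples (i, i_2, .., i_m)
   whose head is i, and the product over the remaining indices i_2, .., i_m. *)
Definition tensor_app (K : comNzRingType) (m n : nat)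
    (T : tensor K m n) (z : 'cV[K]_n) : 'cV[K]_n :=
  \col_i \sum_(t : m.-tuple 'I_n | ohead t == Some i)
            T t * \prod_(j <- behead t) z j 0.

Definition frobenius (R : realType) (m n : nat) (T : tensor R m n) : R :=
  Num.sqrt (\sum_t T t ^+ 2).

Definition Z_eigenvalue (R : realType) (m n : nat) (T : tensor R m n) : set R :=
  [set l | exists2 w : 'cV[R]_n,
             tensor_app T w = l *: w & w^T *m w = 1%:M].

(* For symmetric T with m >= 2 and n >= 1 the set of eigenvalues is nonempty and
   has a largest element (in absolute value), which sup returns; likewise for
   Q_max below. Outside that range sup may be a junk value. *)
Definition Z_radius (R : realType) (m n : nat) (T : tensor R m n) : R :=
  sup [set `|l| | l in Z_eigenvalue T].

Definition tensor_complex (R : realType) (m n : nat) (T : tensor R m n) :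
  tensor R[i] m n := [ffun t => (T t)%:C].

Definition conj_mx (R : realType) (p q : nat) (A : 'M[R[i]]_(p, q)) :
  'M[R[i]]_(p, q) := map_mx (@conjc R) A.

Definition Q_eigenvalue (R : realType) (m n : nat) (T : tensor R m n) : set R :=
  [set l | exists2 z : 'cV[R[i]]_n,
             tensor_app (tensor_complex T) z = l%:C *: conj_mx z &
             (conj_mx z)^T *m z = 1%:M].

Definition Q_max (R : realType) (m n : nat) (T : tensor R m n) : R :=
  sup (Q_eigenvalue T).

Definition sym_nonzero (R : realType) (m n : nat) : set (tensor R m n) :=
  tensor_sym R m n `\ tensor0 R m n.
Arguments sym_nonzero : clear implicits.

Definition rho (R : realType) (m n : nat) : R :=
  sup [set Z_radius T / frobenius T | T in sym_nonzero R m n].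

Definition mu (R : realType) (m n : nat) : R :=
  inf [set Z_radius T / frobenius T | T in sym_nonzero R m n].

Definition QR_ratios (R : realType) (m n : nat) : set R :=
  [set Q_max T / Z_radius T | T in sym_nonzero R m n].
Arguments QR_ratios : clear implicits.

Definition QR_ratio (R : realType) (m n : nat) : R := sup (QR_ratios R m n).

(* Main.v *)
(* Writing z = x + i y, the coefficients of Re (Psi z^m) as a form in (x, y)
   define a real symmetric tensor of dimension 2n with Frobenius norm
   2^((m-1)/2) ||Psi||, and every Q-eigenvalue of Psi is a Z-eigenvalue of it.
   Hence Q(Psi) <= rho(m,2n) 2^((m-1)/2) ||Psi||, while mu(m,n) ||Psi|| <= Z(Psi).
   That mu(m,n) > 0 follows from polarization, which bounds the entries of a
   symmetric tensor by the maximum of |T w^m| on the unit sphere, together with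
   the fact that a maximizer w is a Z-eigenvector.
   The ratio Q/Z is 1 for the m-th tensor power of a basis vector. *)

Require Import Defs.
From mathcomp Require Import all_boot all_order all_algebra all_fingroup.
From mathcomp Require Import complex.
From mathcomp Require Import classical_sets reals exp.
From mathcomp Require Import topology normedtype derive.
From mathcomp Require Import ring lra.

Set Implicit Arguments.
Unset Strict Implicit.
Unset Printing Implicit Defensive.

Import Order.TTheory GRing.Theory Num.Theory.
Import numFieldNormedType.Exports.

Local Open Scope ring_scope.

(** * Multilinear forms of a tensor *)

Definition mform (K : comNzRingType) (m n : nat) (T : tensor K m n)
    (a : 'I_m -> 'I_n -> K) : K :=
  \sum_(t : m.-tuple 'I_n) T t * \prod_(k < m) a k (tnth t k).

Section MultilinearForm.
Variables (K : comNzRingType).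

Lemma eq_mform m n (T : tensor K m n) a b :
  (forall k i, a k i = b k i) -> mform T a = mform T b.
Proof.
move=> ab; apply: eq_bigr => t _; congr (_ * _).
by apply: eq_bigr => k _.
Qed.

(** Distributivity turns the product of the fibre sums into a sum over choice functions [g], grouped
    by the tuple [p \o g]. With [p = tnth s] this is the expansion behind polarization; with [p]
    sending a real coordinate to its complex one, it is the expansion behind realification. *)
Lemma mform_push m n (T : tensor K m n) (J : finType) (p : J -> 'I_n)
    (a : 'I_m -> J -> K) :
  mform T (fun k i => \sum_(j | p j == i) a k j) =
  \sum_(g : {ffun 'I_m -> J}) T [tuple p (g k) | k < m] * \prod_k a k (g k).
Proof.
rewrite (partition_big
  (fun g : {ffun 'I_m -> J} => [tuple p (g k) | k < m]) xpredT) //=.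
apply: eq_bigr => t _; rewrite bigA_distr_big_dep big_distrr /=.
apply: congr_big => // [g|g /familyP gt].
  apply/familyP/eqP => [gt|<- k]; last by rewrite unfold_in tnth_mktuple.
  by apply: eq_from_tnth => k; rewrite tnth_mktuple; apply/eqP/gt.
congr (T _ * _); apply: eq_from_tnth => k; rewrite tnth_mktuple.
by apply/esym/eqP/gt.
Qed.

Lemma mformE m n (T : tensor K m n) a :
  mform T a =
  \sum_(g : {ffun 'I_m -> 'I_n}) T [tuple g k | k < m] * \prod_k a k (g k).
Proof.
rewrite -(mform_push T id); apply: eq_mform => k i.
by rewrite (big_pred1 i).
Qed.

Lemma mform_perm m n (T : tensor K m n) a (s : 'S_m) :
  tensor_sym K m n T -> mform T (fun k => a (s k)) = mform T a.
Proof.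
move=> Tsym; rewrite /mform [RHS](reindex_onto
  (fun t : m.-tuple 'I_n => [tuple tnth t ((s^-1)%g j) | j < m])
  (fun t : m.-tuple 'I_n => [tuple tnth t (s j) | j < m])); last first.
  move=> t _; apply: eq_from_tnth => k.
  by rewrite !tnth_mktuple permKV.
apply: congr_big => // [t|t _].
  apply/esym/eqP; apply: eq_from_tnth => k.
  by rewrite !tnth_mktuple permK.
rewrite Tsym; congr (_ * _); rewrite [RHS](reindex_perm s) /=.
by apply: eq_bigr => k _; rewrite tnth_mktuple permK.
Qed.

Lemma mformZ m n (T : tensor K m n) (c : K) (w : 'I_n -> K) :
  mform T (fun _ i => c * w i) = c ^+ m * mform T (fun=> w).
Proof.
rewrite /mform big_distrr; apply: eq_bigr => t _ /=.
by rewrite big_split /= prodr_const card_ord mulrCA.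
Qed.

(** The head of an index tuple is slot 0 of the form, so pairing with [v] puts [v] in slot 0 and
    leaves [z] in the others. Eigenvalue equations are thereby turned into identities between values
    of [mform]. *)
Lemma tensor_app_dot m n (T : tensor K m.+1 n) (z : 'cV[K]_n) (v : 'I_n -> K) :
  \sum_i v i * tensor_app T z i 0 =
  mform T (fun k i => if k == ord0 then v i else z i 0).
Proof.
rewrite /mform (partition_big (fun t : m.+1.-tuple _ => thead t) xpredT) //=.
apply: eq_bigr => i _; rewrite mxE big_distrr /=.
apply: congr_big => // t; case/tupleP: t => x s.
  by rewrite theadE.
rewrite /= => /eqP[->]; rewrite mulrCA; congr (_ * _).
rewrite big_ord_recl /= tnth0; congr (_ * _).
by rewrite big_tuple; apply: eq_bigr => k _; rewrite tnthS.
Qed.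

Lemma tensor_appE m n (T : tensor K m.+1 n) (z : 'cV[K]_n) i :
  tensor_app T z i 0 =
  mform T (fun k j => if k == ord0 then (j == i)%:R else z j 0).
Proof.
rewrite -tensor_app_dot (bigD1 i) //= eqxx mul1r big1 ?addr0 // => j /negPf->.
by rewrite mul0r.
Qed.

End MultilinearForm.

(** * Derivatives of a form along a line *)

Lemma deriv_prod_ord (K : comNzRingType) m (p : 'I_m -> {poly K}) :
  (\prod_k p k)^`() = \sum_k \prod_j (if j == k then (p j)^`() else p j).
Proof.
elim: m p => [|m IHm] p; first by rewrite !big_ord0 derivC.
rewrite [in LHS]big_ord_recl [RHS]big_ord_recl derivM IHm; congr (_ + _).
  by rewrite big_ord_recl eqxx.
rewrite big_distrr; apply: eq_bigr => k _ /=.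
by rewrite [RHS]big_ord_recl.
Qed.

Section Line.
Variables (K : comNzRingType) (m n : nat) (T : tensor K m n).
Variables (w v : 'I_n -> K).

(** The restriction of the form to the line [w + x v], kept as a formal polynomial so that its
    derivative is computed algebraically. *)
Definition mform_line : {poly K} :=
  \sum_(t : m.-tuple 'I_n)
    (T t)%:P * \prod_k ((w (tnth t k))%:P + (v (tnth t k))%:P * 'X).

Lemma horner_mform_line x :
  mform_line.[x] = mform T (fun _ i => w i + v i * x).
Proof.
rewrite horner_sum; apply: eq_bigr => t _.
rewrite hornerM hornerC horner_prod; congr (_ * _).
by apply: eq_bigr => k _; rewrite !hornerE.
Qed.

Lemma deriv_mform_line :
  mform_line^`().[0] =
  \sum_(k < m) mform T (fun j i => if j == k then v i else w i).
Proof.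
rewrite /mform exchange_big raddf_sum horner_sum; apply: eq_bigr => t _ /=.
rewrite derivM derivC mul0r add0r hornerM hornerC -big_distrr; congr (_ * _).
rewrite deriv_prod_ord horner_sum; apply: eq_bigr => k _.
rewrite horner_prod; apply: eq_bigr => j _.
by case: ifP => _; rewrite ?(derivD, derivM, derivC, derivX) !hornerE.
Qed.

End Line.

(** The product rule gives one term per slot; by symmetry, the transposition of slots 0 and [k]
    makes all of them equal. This is the gradient formula for the diagonal form of a symmetric
    tensor. *)
Lemma deriv_mform_line_sym (K : comNzRingType) m n (T : tensor K m.+1 n)
    (z : 'cV[K]_n) (v : 'I_n -> K) :
  tensor_sym K m.+1 n T ->
  (mform_line T (z^~ 0) v)^`().[0] = (\sum_i v i * tensor_app T z i 0) *+ m.+1.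
Proof.
move=> Tsym; rewrite deriv_mform_line tensor_app_dot -[X in _ *+ X]card_ord -sumr_const.
apply: eq_bigr => k _; rewrite -[RHS](mform_perm _ (tperm ord0 k) Tsym).
apply: eq_mform => j i; congr (if _ then _ else _).
by rewrite -{2}(tpermR ord0 k) (inj_eq perm_inj).
Qed.

Lemma poly_min_deriv0 (R : realType) (p : {poly R}) :
  (forall x, p.[0] <= p.[x]) -> p^`().[0] = 0.
Proof.
move=> pmin.
have d0 : is_derive (0 : R) (1 : R) (horner p) 0.
  apply: (@derive1_at_min _ _ (-1) 1) => //; first by lra.
  by rewrite in_itv /= ltrN10 ltr01.
rewrite -(@derive_val _ _ _ _ _ _ _ (is_derive_poly p 0)).
exact: (@derive_val _ _ _ _ _ _ _ d0).
Qed.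

(** * Maximizers of a form on the unit sphere *)

Section Extremal.
Variable R : realType.

Lemma continuous_mform_diag m n (T : tensor R m n) :
  continuous (fun w : 'rV[R]_n => mform T (fun=> w ord0)).
Proof.
apply: continuous_big => [|t _]; first exact: add_continuous.
have cprod : continuous (fun w : 'rV[R]_n => \prod_k w ord0 (tnth t k)).
  by apply: (continuous_big (@mul_continuous R)) => k _; exact: coord_continuous.
by move=> w; exact: (cvgM (cvg_cst _) (cprod w)).
Qed.

Lemma continuous_sqnorm n :
  continuous (fun w : 'rV[R]_n => \sum_i w ord0 i ^+ 2).
Proof.
apply: (continuous_big (@add_continuous R)) => i _ w.
exact: (cvgM (@coord_continuous _ _ _ ord0 i w) (@coord_continuous _ _ _ ord0 i w)).
Qed.

(** The unit sphere is closed in the compact cube [-1, 1]^n, and it contains a basis vector because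
    [0 < n]; the extreme value theorem applies. *)
Lemma sphere_max n (f : 'rV[R]_n -> R) :
  (0 < n)%N -> continuous f ->
  exists2 w : 'rV[R]_n, \sum_i w ord0 i ^+ 2 = 1 &
    forall u : 'rV[R]_n, \sum_i u ord0 i ^+ 2 = 1 -> f u <= f w.
Proof.
case: n f => // n f _ cf.
pose S := [set w : 'rV[R]_n.+1 | \sum_i w ord0 i ^+ 2 = 1]%classic.
have cS : compact S.
  apply: (@subclosed_compact _ _ [set w : 'rV[R]_n.+1 |
      forall i, (fun=> `[(-1 : R), 1]%classic) i (w ord0 i)]%classic).
  - rewrite (_ : S = (fun w : 'rV[R]_n.+1 => \sum_i w ord0 i ^+ 2) @^-1`
                       [set 1])%classic //.
    have /continuous_closedP := @continuous_sqnorm n.+1; apply; exact: closed_eq.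
  - apply: (@rV_compact R n.+1 (fun=> `[(-1 : R), 1]%classic)) => _.
    exact: segment_compact.
  - move=> w /= Sw i; rewrite in_itv /= -ler_norml -(@expr_le1 _ 2) //.
    rewrite real_normK ?num_real // -Sw (bigD1 i) //= lerDl.
    by apply: sumr_ge0 => j _; exact: sqr_ge0.
have S0 : (S !=set0)%classic.
  exists (delta_mx ord0 ord0); rewrite /S /= (bigD1 ord0) //= mxE !eqxx expr1n.
  by rewrite big1 ?addr0 // => i /negPf i0; rewrite mxE i0 andbF expr0n.
have [w Sw wmax] := EVT_max_rV S0 cS (continuous_subspaceT cf).
exists w => [|u Su]; first by rewrite inE in Sw.
by apply: wmax; rewrite inE.
Qed.

(** Maximizing the square handles both signs of the form at once. Homogeneity then extends the bound
    from the sphere to all [u], so that it can be used along straight lines, which leave the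
    sphere. *)
Lemma mform_max m n (T : tensor R m n) : (0 < n)%N ->
  exists2 w : 'I_n -> R, \sum_i w i ^+ 2 = 1 &
    forall u, mform T (fun=> u) ^+ 2 <=
              mform T (fun=> w) ^+ 2 * (\sum_i u i ^+ 2) ^+ m.
Proof.
move=> n0.
have [w Sw wmax] := @sphere_max n (fun w => mform T (fun=> w ord0) ^+ 2) n0
  (fun w => cvgM (@continuous_mform_diag m n T w) (@continuous_mform_diag m n T w)).
exists (w ord0) => // u.
set N := \sum_i u i ^+ 2.
have N0 : 0 <= N by apply: sumr_ge0 => i _; exact: sqr_ge0.
pose r := Num.sqrt N.
have r2 : r ^+ 2 = N by rewrite sqr_sqrtr.
have [r0|r0] := eqVneq r 0.
  have u0 i : u i = 0.
    apply/eqP; rewrite -sqrf_eq0.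
    have : N == 0 by rewrite -r2 r0 expr0n.
    rewrite psumr_eq0 => [/allP/(_ i)|j _]; last exact: sqr_ge0.
    by apply; exact: mem_index_enum.
  (* Writing the zero vector as [0 * w] puts the same power of 0 on both sides, which is correct for
     [m = 0] too. *)
  have -> : mform T (fun=> u) = mform T (fun _ i => 0 * w ord0 i).
    by apply: eq_mform => _ i; rewrite u0 mul0r.
  by rewrite mformZ exprMn -exprM mulnC exprM -r2 r0 mulrC.
have -> : mform T (fun=> u) = r ^+ m * mform T (fun _ i => r^-1 * u i).
  by rewrite -mformZ; apply: eq_mform => _ i; rewrite mulVKf.
rewrite exprMn -exprM mulnC exprM r2 mulrC ler_wpM2r ?exprn_ge0 //.
have := wmax (\row_i (r^-1 * u i)).
rewrite (_ : \sum_i _ = 1) => [/(_ erefl)|].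
  rewrite (_ : mform T (fun=> (\row_i (r^-1 * u i)) ord0) =
               mform T (fun _ i => r^-1 * u i)) //.
  by apply: eq_mform => _ i; rewrite mxE.
under eq_bigr => i _ do rewrite mxE exprMn.
by rewrite -big_distrr /= -/N -r2 exprVn mulVf // sqrf_eq0.
Qed.

(* The polynomial l^2 N(x)^m - F(x)^2 along each line through w is minimal at
   x = 0, and its derivative there is 2 m l (l w - T w^(m-1)) . v. *)
Lemma mform_max_eigen m n (T : tensor R m.+1 n) (w : 'cV[R]_n) :
  tensor_sym R m.+1 n T -> \sum_i w i 0 ^+ 2 = 1 ->
  mform T (fun=> w^~ 0) != 0 ->
  (forall u, mform T (fun=> u) ^+ 2 <=
             mform T (fun=> w^~ 0) ^+ 2 * (\sum_i u i ^+ 2) ^+ m.+1) ->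
  Z_eigenvalue T (mform T (fun=> w^~ 0)).
Proof.
move=> Tsym Sw; set l := mform _ _ => l0 wmax.
exists w; last first.
  apply/matrixP => i j; rewrite !ord1 !mxE eqxx -[RHS]Sw.
  by apply: eq_bigr => k _; rewrite mxE.
apply/matrixP => i j; rewrite ord1 {j} [RHS]mxE.
pose v k : R := (k == i)%:R.
pose N : {poly R} := \sum_k ((w k 0)%:P + (v k)%:P * 'X) ^+ 2.
pose P : {poly R} := (l ^+ 2)%:P * N ^+ m.+1 - mform_line T (w^~ 0) v ^+ 2.
have NE x : N.[x] = \sum_k (w k 0 + v k * x) ^+ 2.
  by rewrite horner_sum; apply: eq_bigr => k _; rewrite !hornerE.
have N0 : N.[0] = 1.
  by rewrite NE -[RHS]Sw; apply: eq_bigr => k _; rewrite mulr0 addr0.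
have F0 : (mform_line T (w^~ 0) v).[0] = l.
  by rewrite horner_mform_line; apply: eq_mform => k j; rewrite mulr0 addr0.
have PE x : P.[x] = l ^+ 2 * N.[x] ^+ m.+1 - (mform_line T (w^~ 0) v).[x] ^+ 2.
  by rewrite /P hornerD hornerN !hornerM hornerC !horner_exp.
have Pmin x : P.[0] <= P.[x].
  by rewrite !PE N0 F0 expr1n mulr1 subrr horner_mform_line NE subr_ge0 wmax.
move/poly_min_deriv0: Pmin.
rewrite /P derivB derivM derivC mul0r add0r !deriv_exp hornerD hornerN.
rewrite !(hornerMn, hornerM, hornerC) !horner_exp N0 F0 expr1n expr1 mulr1.
rewrite deriv_mform_line_sym // (bigD1 i) //= /v eqxx mul1r big1 ?addr0; last first.
  by move=> k /negPf->; rewrite mul0r.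
have -> : N^`().[0] = 2 * w i 0.
  rewrite raddf_sum horner_sum (bigD1 i) //= big1 => [|k /negPf ki].
    rewrite deriv_exp derivD derivM !derivC derivX !hornerE /v eqxx expr1 /=.
    by ring.
  by rewrite deriv_exp derivD derivM !derivC derivX !hornerE /v ki !mul0r addr0.
rewrite -(mulr_natr (2 * w i 0)) -(mulr_natr (tensor_app T w i 0)).
rewrite -(mulr_natr _ 2) => H.
(* The vanishing derivative is the [i]-th component of the eigenvalue equation times 2 (m+1) l; this
   factor is cancelled using [l != 0]. *)
have m0 : m.+1%:R != 0 :> R by rewrite pnatr_eq0.
apply: (mulfI (mulf_neq0 l0 m0)); apply: (mulfI (_ : 2%:R != 0 :> R)).
  by rewrite pnatr_eq0.
apply/eqP; rewrite -subr_eq0 -oppr_eq0; apply/eqP; rewrite -[RHS]H; ring.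
Qed.

End Extremal.

(* Only the injective g survive in the expansion of the form at the vectors
   sum_j (+-) e_(s_j): an index j missed by g carries the factor 1 + (-1). *)
Lemma polarization (K : comNzRingType) m n (T : tensor K m n)
    (s : m.-tuple 'I_n) : tensor_sym K m n T ->
  \sum_(e : {ffun 'I_m -> bool}) (\prod_k (-1) ^+ e k) *
     mform T (fun _ i => \sum_(j | tnth s j == i) (-1) ^+ e j) =
  T s *+ (2 ^ m * #|[set g : {ffun 'I_m -> 'I_m} | injectiveb g]|).
Proof.
move=> Tsym.
under eq_bigr => e _ do rewrite mform_push big_distrr /=.
rewrite exchange_big (bigID (fun g : {ffun 'I_m -> 'I_m} => injectiveb g)) /=.
rewrite [X in _ + X]big1 ?addr0 => [|g /injectivePn ninj]; last first.
  have [j0 gj0] : exists j0, j0 \notin codom g.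
    apply/existsP; rewrite -negb_forall; apply/negP => /forallP gsurj.
    case: ninj => x [y /negP xy gxy]; apply: xy; apply/eqP.
    have /card_uniqP : #|codom g| = size (codom g).
      rewrite size_codom; apply: eq_card => j; rewrite !inE; exact: gsurj.
    by move/injectiveP; apply.
  under eq_bigr => e _ do rewrite mulrCA.
  rewrite -big_distrr /=; set S := (X in _ * X).
  suff -> : S = 0 by rewrite mulr0.
  (* The sign of [j] occurs once in the prefactor and once for each [k] with [g k = j]; grouped this
     way, the sum over [e] factors over the indices [j]. *)
  have -> : S = \sum_(e : {ffun 'I_m -> bool})
      \prod_j ((-1) ^+ e j * (-1) ^+ e j ^+ #|[set k | g k == j]|).
    apply: eq_bigr => e _; rewrite big_split /=; congr (_ * _).
    rewrite (partition_big g xpredT) //=; apply: eq_bigr => j _.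
    rewrite -prodr_const; apply: congr_big => // [k|k /eqP-> //].
    by rewrite inE.
  rewrite -(bigA_distr_bigA
    (fun j (b : bool) => (-1) ^+ b * (-1) ^+ b ^+ #|[set k | g k == j]|)).
  rewrite (bigD1 j0) //= (_ : [set k | g k == j0] = finset.set0).
    by rewrite cards0 big_bool /= !expr0 expr1 !mulr1 addNr mul0r.
  apply/finset.setP => k; rewrite !inE; apply: contraNF gj0 => /eqP <-.
  exact: codom_f.
(* An injective [g] is a permutation: symmetry gives back [T s], and every sign occurs exactly
   twice, so each of the 2^m choices of [e] contributes [T s]. *)
have inj_term (g : {ffun 'I_m -> 'I_m}) : injectiveb g ->
    \sum_(e : {ffun 'I_m -> bool}) (\prod_k (-1) ^+ e k) *
       (T [tuple tnth s (g k) | k < m] * \prod_k (-1) ^+ e (g k)) =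
    T s *+ 2 ^ m.
  move=> /injectiveP ginj.
  have -> : T [tuple tnth s (g k) | k < m] = T s.
    rewrite -(Tsym (perm ginj) s); congr (T _).
    by apply: eq_from_tnth => k; rewrite !tnth_mktuple permE.
  transitivity (\sum_(e : {ffun 'I_m -> bool}) T s); last first.
    by rewrite sumr_const card_ffun card_bool card_ord.
  apply: eq_bigr => e _; rewrite mulrCA.
  rewrite [X in _ * (X * _)](reindex_inj ginj) /= -big_split /= big1 ?mulr1 // => k _.
  by rewrite -expr2 sqrr_sign.
rewrite (eq_bigr _ inj_term) sumr_const mulrnA; congr (_ *+ _).
by apply: eq_card => g; rewrite !inE.
Qed.

(** * Comparison of the Frobenius norm with the Z-spectral radius *)

Section Norms.
Variable R : realType.

Lemma frobenius_ge0 m n (T : tensor R m n) : 0 <= frobenius T.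
Proof. exact: sqrtr_ge0. Qed.

Lemma frobenius_sqr m n (T : tensor R m n) : frobenius T ^+ 2 = \sum_t T t ^+ 2.
Proof. by rewrite sqr_sqrtr // sumr_ge0 // => t _; exact: sqr_ge0. Qed.

Lemma entry_le_frobenius m n (T : tensor R m n) t : `|T t| <= frobenius T.
Proof.
rewrite -sqrtr_sqr ler_sqrt; last by apply: sumr_ge0 => *; exact: sqr_ge0.
by rewrite (bigD1 t) //= lerDl sumr_ge0 // => *; exact: sqr_ge0.
Qed.

Lemma frobenius_gt0 m n (T : tensor R m n) : T <> tensor0 R m n -> 0 < frobenius T.
Proof.
move=> T0; rewrite lt_neqAle frobenius_ge0 andbT eq_sym; apply/eqP => T1.
apply: T0; apply/ffunP => t; rewrite ffunE; apply/eqP.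
by rewrite -normr_le0 -T1 entry_le_frobenius.
Qed.

(** Polarization writes each entry through values of the form at finitely many vectors of bounded
    length, and the hypothesis on [l] bounds these values; the entries in turn bound the Frobenius
    norm. *)
Lemma frobenius_le_max m n : (0 < m)%N -> (0 < n)%N ->
  exists2 D : R, 0 < D & forall (T : tensor R m n) l, tensor_sym R m n T ->
    (forall u, mform T (fun=> u) ^+ 2 <= l ^+ 2 * (\sum_i u i ^+ 2) ^+ m) ->
    frobenius T <= D * `|l|.
Proof.
move=> m0 n0.
(* A polarization vector has [n] coordinates, each a sum of at most [m] signs, so its squared length
   is at most n m^2. The factor 2^m in [C] counts the sign choices, and n^m below counts the
   entries. *)
pose B : R := Num.sqrt ((n%:R * m%:R ^+ 2) ^+ m).
have B0 : 0 < B.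
  by rewrite sqrtr_gt0 exprn_gt0 // mulr_gt0 ?exprn_gt0 ?ltr0n.
pose C : R := 2 ^+ m * B.
have C0 : 0 < C by rewrite mulr_gt0 ?exprn_gt0.
exists (Num.sqrt (n ^ m)%:R * C).
  by rewrite mulr_gt0 // sqrtr_gt0 ltr0n expn_gt0 n0.
move=> T l Tsym Tl.
have TB (u : 'I_n -> R) :
    (forall i, `|u i| <= m%:R) -> `|mform T (fun=> u)| <= `|l| * B.
  move=> um; rewrite -ler_sqr ?nnegrE ?mulr_ge0 ?(ltW B0) //.
  rewrite exprMn !real_normK ?num_real // (le_trans (Tl u)) // ler_wpM2l ?sqr_ge0 //.
  rewrite sqr_sqrtr ?exprn_ge0 ?mulr_ge0 ?sqr_ge0 //.
  rewrite lerXn2r ?nnegrE ?mulr_ge0 ?sqr_ge0 //.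
    by apply: sumr_ge0 => *; exact: sqr_ge0.
  rewrite -[n in n%:R]card_ord mulr_natl -sumr_const; apply: ler_sum => i _.
  by rewrite -[u i ^+ 2]real_normK ?num_real // lerXn2r ?nnegrE.
have Tt t : `|T t| <= C * `|l|.
  (* The multiplicity of [T s] in polarization is at least 1, since the identity is injective; hence
     the multiple dominates the entry itself. *)
  have N0 : (0 < 2 ^ m * #|[set g : {ffun 'I_m -> 'I_m} | injectiveb g]|)%N.
    rewrite muln_gt0 expn_gt0 /=; apply/card_gt0P; exists [ffun k => k].
    by rewrite inE; apply/injectiveP => x y; rewrite !ffunE.
  have : `|T t| <= `|T t *+ (2 ^ m * #|[set g : {ffun 'I_m -> 'I_m} | injectiveb g]|)|.
    by rewrite normrMn -mulr_natr ler_peMr ?ler1n.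
  move/le_trans; apply; rewrite -polarization // (le_trans (ler_norm_sum _ _ _)) //.
  rewrite (_ : C * `|l| = \sum_(e : {ffun 'I_m -> bool}) (`|l| * B)); last first.
    by rewrite sumr_const card_ffun card_bool card_ord -mulr_natr natrX /C; ring.
  apply: ler_sum => e _; rewrite normrM normr_prod big1 => [|k _]; last first.
    by rewrite normrX normrN1 expr1n.
  rewrite mul1r TB // => i; rewrite (le_trans (ler_norm_sum _ _ _)) //.
  under eq_bigr => j _ do rewrite normrX normrN1 expr1n.
  by rewrite sumr_const ler_nat -[m in (_ <= m)%N]card_ord max_card.
have D0 : 0 <= C * `|l| by rewrite mulr_ge0 // ltW.
rewrite -(mulrA _ C) -ler_sqr ?nnegrE ?frobenius_ge0 ?(mulr_ge0 (sqrtr_ge0 _) D0) //.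
rewrite frobenius_sqr exprMn sqr_sqrtr ?ler0n //.
have <- : #|{: m.-tuple 'I_n}| = (n ^ m)%N by rewrite card_tuple card_ord.
rewrite mulr_natl -sumr_const; apply: ler_sum => t _.
by rewrite -[T t ^+ 2]real_normK ?num_real // lerXn2r ?nnegrE.
Qed.

(** Pairing the eigenvalue equation with the unit vector [w] gives the value of the form at [w]. *)
Lemma Z_eigenvalueE m n (T : tensor R m.+1 n) l : Z_eigenvalue T l ->
  exists2 w : 'I_n -> R, forall i, `|w i| <= 1 & l = mform T (fun=> w).
Proof.
case=> w Tw ww.
have Sw : \sum_i w i 0 ^+ 2 = 1.
  have /matrixP/(_ 0 0) := ww; rewrite !mxE eqxx mulr1n => E; rewrite -[RHS]E.
  by apply: eq_bigr => i _; rewrite mxE expr2.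
exists (w^~ 0) => [i|].
  rewrite -(@expr_le1 _ 2) // real_normK ?num_real // -Sw (bigD1 i) //= lerDl.
  by apply: sumr_ge0 => *; exact: sqr_ge0.
rewrite -[l]mulr1 -Sw big_distrr /= (eq_bigr (fun i => w i 0 * tensor_app T w i 0)).
  by rewrite (tensor_app_dot T w (w^~ 0)); apply: eq_mform => k i; case: ifP.
by move=> i _; rewrite Tw mxE; ring.
Qed.

(** A crude count of terms, each at most the Frobenius norm. It makes the suprema in [Z_radius] and
    [rho] those of bounded sets. *)
Lemma Z_eigenvalue_le m n (T : tensor R m.+1 n) l :
  Z_eigenvalue T l -> `|l| <= (n ^ m.+1)%:R * frobenius T.
Proof.
move=> /Z_eigenvalueE[w w1 ->]; rewrite (le_trans (ler_norm_sum _ _ _)) //.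
have <- : #|{: m.+1.-tuple 'I_n}| = (n ^ m.+1)%N by rewrite card_tuple card_ord.
rewrite mulr_natl -sumr_const; apply: ler_sum => t _.
rewrite normrM -[X in _ <= X]mulr1 ler_pM ?entry_le_frobenius //.
by rewrite normr_prod; apply: prodr_ile1 => k _; rewrite normr_ge0 w1.
Qed.

Lemma Z_eigenvalues_has_ubound m n (T : tensor R m.+1 n) :
  has_ubound [set `|l| | l in Z_eigenvalue T]%classic.
Proof.
by exists ((n ^ m.+1)%:R * frobenius T) => _ [l Tl <-]; exact: Z_eigenvalue_le.
Qed.

Lemma Z_radius_ge m n (T : tensor R m.+1 n) l :
  Z_eigenvalue T l -> `|l| <= Z_radius T.
Proof.
by move=> Tl; apply: ub_le_sup; [exact: Z_eigenvalues_has_ubound|exists l].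
Qed.

Lemma Z_radius_ge0 m n (T : tensor R m.+1 n) : 0 <= Z_radius T.
Proof.
(* The supremum of the empty set is 0 by convention, so the bound holds without first proving that
   eigenvalues exist. *)
have [E|/set0P[_ [l Tl _]]] := eqVneq [set `|l| | l in Z_eigenvalue T]%classic set0.
  by rewrite /Z_radius E sup0.
exact: le_trans (normr_ge0 l) (Z_radius_ge Tl).
Qed.

Lemma Z_radius_le m n (T : tensor R m.+1 n) :
  Z_radius T <= (n ^ m.+1)%:R * frobenius T.
Proof.
have [E|/set0P ne] := eqVneq [set `|l| | l in Z_eigenvalue T]%classic set0.
  by rewrite /Z_radius E sup0 mulr_ge0 ?frobenius_ge0.
by apply: ge_sup => // _ [l Tl <-]; exact: Z_eigenvalue_le.
Qed.

(** At a maximizer [w] the value [l] of the form satisfies ||T|| <= D |l|. Hence [l] is nonzero, so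
    it is a Z-eigenvalue and |l| <= Z(T); the constant is 1/D. *)
Lemma Z_radius_lower_bound m n : (0 < n)%N ->
  exists2 c : R, 0 < c & forall T : tensor R m.+1 n,
    sym_nonzero R m.+1 n T -> c <= Z_radius T / frobenius T.
Proof.
move=> n0; have [D D0 HD] := @frobenius_le_max m.+1 n isT n0.
exists D^-1; first by rewrite invr_gt0.
move=> T [Tsym T0]; have F0 := frobenius_gt0 T0.
have [w Sw wmax] := mform_max T n0.
set l := mform T _ in wmax.
have TD := HD T l Tsym wmax.
have l0 : l != 0.
  by apply/eqP => l0; move: TD; rewrite l0 normr0 mulr0 leNgt F0.
pose W : 'cV[R]_n := \col_i w i.
have WE : l = mform T (fun=> W^~ 0) by apply: eq_mform => k i; rewrite mxE.
rewrite WE in l0 wmax TD *.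
have Tl : Z_eigenvalue T (mform T (fun=> W^~ 0)).
  by apply: mform_max_eigen => //; rewrite -Sw; apply: eq_bigr => i _; rewrite mxE.
rewrite ler_pdivlMr // mulrC ler_pdivrMr // mulrC (le_trans TD) //.
by rewrite ler_pM2l // Z_radius_ge.
Qed.

Lemma rho_has_ubound m n : has_ubound
  [set Z_radius T / frobenius T | T in sym_nonzero R m.+1 n]%classic.
Proof.
exists (n ^ m.+1)%:R => _ [T [_ /frobenius_gt0 F0] <-].
by rewrite ler_pdivrMr // Z_radius_le.
Qed.

End Norms.

(** * Realification: from complex dimension n to real dimension 2n *)

Section Realification.
Variable R : realType.

Local Notation Re := (@complex.Re R).
Local Notation Im := (@complex.Im R).

Section Index.
Variable n : nat.

(** The 2n real coordinates are the entries of a 2 by n matrix: row 0 holds real parts, row 1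
    imaginary parts. The row number thus serves as the exponent of the imaginary unit. *)
Definition reim_index (i : 'I_(2 * n)) : 'I_2 * 'I_n :=
  enum_val (cast_ord (esym (mxvec_cast 2 n)) i).

Local Notation im i := (reim_index i).1.
Local Notation part i := (reim_index i).2.

Lemma reim_index_mxvec b j : reim_index (mxvec_index b j) = (b, j).
Proof. by rewrite /reim_index /mxvec_index cast_ordK enum_rankK. Qed.

Lemma reim_indexK i : mxvec_index (im i) (part i) = i.
Proof.
by rewrite /mxvec_index -surjective_pairing enum_valK cast_ordKV.
Qed.

Lemma sum_reim (V : nmodType) (f : 'I_(2 * n) -> V) j :
  \sum_(i | part i == j) f i = f (mxvec_index 0 j) + f (mxvec_index 1 j).
Proof.
rewrite (reindex_onto (fun b : 'I_2 => mxvec_index b j) (fun i => im i)) /=.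
  rewrite (eq_bigl xpredT) => [|b]; last by rewrite reim_index_mxvec !eqxx.
  rewrite big_ord_recl big_ord1; congr (_ + f (mxvec_index _ j)).
  exact: val_inj.
by move=> i /eqP <-; exact: reim_indexK.
Qed.

End Index.

Local Notation im i := (reim_index i).1.
Local Notation part i := (reim_index i).2.
Local Notation imag := ('i%C : R[i]).

Lemma Re_sum (I : Type) (r : seq I) (P : pred I) (F : I -> R[i]) :
  Re (\sum_(i <- r | P i) F i) = \sum_(i <- r | P i) Re (F i).
Proof. by elim/big_rec2: _ => // i x [a b] _ <-; case: (F i). Qed.

Lemma Re_scale (x : R) (y : R[i]) : Re (x%:C%C * y) = x * Re y.
Proof. by case: y => c d /=; rewrite mul0r subr0. Qed.

(** The square is 1 for even [N] and 0 for odd [N]. The form 1 + (-1)^N is multiplicative in each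
    summand, so sums over index tuples factor over the slots. *)
Lemma Re_imag_sqr N : Re (imag ^+ N) ^+ 2 *+ 2 = 1 + (-1) ^+ N.
Proof.
have imag2 : imag ^+ 2 = -1 by exact: sqr_i.
have ReN (x : R[i]) : Re (- x) = - Re x by case: x.
(* Two consecutive exponents are carried through the induction because i^(N+2) = - i^N. *)
suff : Re (imag ^+ N) ^+ 2 *+ 2 = 1 + (-1) ^+ N /\
       Re (imag ^+ N.+1) ^+ 2 *+ 2 = 1 + (-1) ^+ N.+1 by case.
elim: N => [|N [IH1 IH2]].
  by rewrite !expr0 !expr1 /= expr1n expr0n mul0rn subrr mulr2n.
split=> //; rewrite -[N.+2]addn2 !exprD imag2 mulrN1 ReN !sqrrN.
by rewrite !expr1n mulr1 IH1.
Qed.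

(* The coefficients of the form Re (T z^m) in the 2n real variables Re z_j, Im z_j. *)
Definition realify m n (T : tensor R m n) : tensor R m (2 * n) :=
  [ffun t => T [tuple part (tnth t k) | k < m] *
             Re (imag ^+ \sum_(k < m) im (tnth t k))].

Lemma realify_sym m n (T : tensor R m n) :
  tensor_sym R m n T -> tensor_sym R m (2 * n) (realify T).
Proof.
move=> Tsym s t; rewrite !ffunE; congr (_ * Re (_ ^+ _)); last first.
  by rewrite [RHS](reindex_perm s); apply: eq_bigr => k _; rewrite tnth_mktuple.
rewrite -[RHS](Tsym s); congr (T _); apply: eq_from_tnth => k.
by rewrite !tnth_mktuple.
Qed.

(** Expanding every slot collects the powers of the imaginary unit into one exponent, whose real
    part is the coefficient in [realify]. Slots may carry different vectors, as the eigenvalue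
    equation requires. *)
Lemma mform_realify m n (T : tensor R m n) (a : 'I_m -> 'I_(2 * n) -> R) :
  mform (realify T) a =
  Re (mform (tensor_complex T)
        (fun k j => \sum_(i | part i == j) imag ^+ im i * (a k i)%:C%C)).
Proof.
rewrite mform_push mformE Re_sum; apply: eq_bigr => g _.
rewrite !ffunE Re_scale big_split /= -rmorph_prod [X in _ = _ * Re X]mulrC Re_scale.
rewrite -mulrA [Re _ * _]mulrC prodrXr; congr (T _ * (_ * Re (_ ^+ _))).
  by apply: eq_from_tnth => k; rewrite !tnth_mktuple.
by apply: eq_bigr => k _; rewrite tnth_mktuple.
Qed.

(** Each index tuple of [T] lifts to 2^(m+1) tuples, and exactly half of them, those with an even
    number of imaginary parts, carry the entry up to sign; the others carry 0. *)
Lemma frobenius_realify m n (T : tensor R m.+1 n) :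
  frobenius (realify T) = Num.sqrt (2 ^+ m) * frobenius T.
Proof.
rewrite -sqrtrM ?exprn_ge0 //; congr Num.sqrt.
apply: (mulIf (_ : 2 != 0 :> R)); first by rewrite pnatr_eq0.
pose T2 : tensor R m.+1 n := [ffun t => T t ^+ 2].
(* [S] weights the lifts of each squared entry by a product of [f] over the slots: [f = 1] counts
   all lifts, while f(b) = (-1)^b counts even minus odd ones and vanishes because slot 0 contributes
   1 - 1. *)
pose S (f : 'I_2 -> R) := mform T2 (fun _ j => \sum_(i | part i == j) f (im i)).
have S1 : S (fun=> 1) = 2 ^+ m.+1 * \sum_t T t ^+ 2.
  rewrite /S /mform big_distrr /=; apply: eq_bigr => t _; rewrite ffunE mulrC.
  congr (_ * _); rewrite -[in RHS](card_ord m.+1) -prodr_const.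
  by apply: eq_bigr => k _; rewrite sum_reim.
have S2 : S (fun b => (-1) ^+ b) = 0.
  rewrite /S /mform big1 // => t _; rewrite big_ord_recl sum_reim !reim_index_mxvec.
  by rewrite /= expr0 expr1 subrr mul0r mulr0.
transitivity (S (fun=> 1) + S (fun b => (-1) ^+ b)); last first.
  by rewrite S1 S2 addr0 exprSr mulrAC.
rewrite /S !mform_push -big_split /= mulr_suml.
rewrite (reindex (fun g : {ffun 'I_m.+1 -> 'I_(2 * n)} => [tuple g k | k < m.+1])) /=.
  apply: eq_bigr => g _; rewrite /T2 !ffunE big1_eq prodrXr.
  rewrite -mulrDr -Re_imag_sqr exprMn -mulrA.
  rewrite (mulr_natr _ 2); congr (T _ ^+ 2 * (Re (_ ^+ _) ^+ 2 *+ 2)).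
    by apply: eq_from_tnth => k; rewrite !tnth_mktuple.
  by apply: eq_bigr => k _; rewrite tnth_mktuple.
exists (fun t => [ffun k => tnth t k]) => [g _|t _].
  by apply/ffunP => k; rewrite ffunE tnth_mktuple.
by apply: eq_from_tnth => k; rewrite tnth_mktuple ffunE.
Qed.

(** The eigenvector is (Re z, Im z). The conjugate in the Q-equation makes the signs agree: Re (l
    conj z_j) = l Re z_j and Re (i l conj z_j) = l Im z_j. *)
Lemma Q_eigenvalue_realify m n (T : tensor R m.+1 n) l :
  Q_eigenvalue T l -> Z_eigenvalue (realify T) l.
Proof.
case=> z Tz zz.
pose u : 'cV[R]_(2 * n) :=
  \col_i (if im i == 0 then Re (z (part i) 0) else Im (z (part i) 0)).
exists u.
  apply/matrixP => i j; rewrite {j}ord1 [RHS]mxE tensor_appE mform_realify.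
  (* The complex vector represented by the [i]-th real basis vector: a basis vector, or the
     imaginary unit times one. *)
  pose v j : R[i] := if part i == j then imag ^+ im i else 0.
  rewrite (_ : mform _ _ = mform (tensor_complex T)
       (fun k j => if k == ord0 then v j else z j 0)).
    rewrite -tensor_app_dot (bigD1 (part i)) //= big1 => [|j ji]; last first.
      by rewrite /v eq_sym (negPf ji) mul0r.
    rewrite /v eqxx addr0 Tz !mxE; case: (z _ _) => x y.
    have [->|i1] := eqVneq (im i) 0.
      by rewrite expr0 mul1r Re_scale.
    have -> : im i = 1 by apply/val_inj; case: (im i) i1 => [[|[|k]]].
    by rewrite expr1 mulrCA Re_scale /=; ring.
  apply: eq_mform => k j; have [_|_] := eqVneq k ord0.
    rewrite /v; have [ij|ij] := eqVneq (part i) j.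
      rewrite (bigD1 i) /= ?ij // eqxx big1 ?addr0 ?mulr1 // => i' /andP[_ /negPf->].
      by rewrite mulr0.
    rewrite big1 // => i' /eqP i'j; have [ii'|] := eqVneq i' i; last by rewrite mulr0.
    by rewrite -ii' i'j eqxx in ij.
  rewrite sum_reim !mxE !reim_index_mxvec /= expr0 expr1 mul1r [RHS]complexE.
  by [].
apply/matrixP => i j; rewrite !ord1 !mxE eqxx.
have /matrixP/(_ 0 0) := zz; rewrite !mxE eqxx => /(congr1 Re) /=.
rewrite Re_sum => E; rewrite -[RHS]E.
rewrite (partition_big (fun i => part i) xpredT) //=; apply: eq_bigr => k _.
rewrite sum_reim !mxE !reim_index_mxvec /=.
by case: (z k 0) => x y /=; ring.
Qed.

End Realification.

(** * The extremal example for the lower bound *)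

Section PureTensor.
Variables (K : comNzRingType) (m n : nat).

(** The [m]-th tensor power of the first basis vector. *)
Definition pure_tensor : tensor K m n.+1 :=
  [ffun t => [forall k, tnth t k == ord0]%:R].

Lemma pure_tensor_sym : tensor_sym K m n.+1 pure_tensor.
Proof.
move=> s t; rewrite !ffunE; congr (_%:R); congr (nat_of_bool _).
apply/forallP/forallP => /= t0 k; last by rewrite tnth_mktuple.
by have := t0 ((s^-1)%g k); rewrite tnth_mktuple permKV.
Qed.

Lemma pure_tensor_neq0 : pure_tensor <> tensor0 K m n.+1.
Proof.
move/ffunP/(_ [tuple ord0 | _ < m]); rewrite !ffunE.
rewrite (_ : [forall _, _]) => [/eqP|]; first by rewrite oner_eq0.
by apply/forallP => k; rewrite tnth_mktuple.
Qed.

Lemma mform_pure_tensor a : mform pure_tensor a = \prod_k a k ord0.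
Proof.
rewrite /mform (bigD1 [tuple ord0 | _ < m]) //= [X in _ + X]big1 ?addr0 => [|t].
  rewrite ffunE (_ : [forall _, _]) ?mulr1n ?mul1r.
    by apply: eq_bigr => k _; rewrite tnth_mktuple.
  by apply/forallP => k; rewrite tnth_mktuple.
rewrite ffunE; case: forallP => [t0 /eqP[]|]; last by rewrite mul0r.
by apply: eq_from_tnth => k; rewrite tnth_mktuple; apply/eqP.
Qed.

End PureTensor.

(** * Bounds on the QR-ratio *)

Section Ratio.
Variable R : realType.

Lemma Q_eigenvalue_pure_tensor m n : Q_eigenvalue (pure_tensor R m.+2 n) 1.
Proof.
exists (delta_mx ord0 0); last first.
  apply/matrixP => i j; rewrite !ord1 /conj_mx !mxE (bigD1 ord0) //=.
  rewrite !mxE !eqxx rmorph_nat mulr1.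
  by rewrite big1 ?addr0 // => k /negPf k0; rewrite !mxE k0 mulr0.
have -> : tensor_complex (pure_tensor R m.+2 n) = pure_tensor R[i] m.+2 n.
  by apply/ffunP => t; rewrite !ffunE rmorph_nat.
apply/matrixP => i j; rewrite ord1 tensor_appE mform_pure_tensor !mxE.
rewrite big_ord_recl /= [X in _ * X]big1 //.
by rewrite mulr1 mul1r andbT rmorph_nat eq_sym.
Qed.

(** Each Z-eigenvalue is a power of the first coordinate of a unit vector. *)
Lemma Z_radius_pure_tensor m n : Z_radius (pure_tensor R m.+1 n) <= 1.
Proof.
have [E|/set0P ne] :=
    eqVneq [set `|l| | l in Z_eigenvalue (pure_tensor R m.+1 n)]%classic set0.
  by rewrite /Z_radius E sup0.
apply: ge_sup => // _ [l /Z_eigenvalueE[w w1 ->] <-].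
rewrite mform_pure_tensor normr_prod.
by apply: prodr_ile1 => k _; rewrite normr_ge0 w1.
Qed.

Lemma Q_eigenvalue_le m n (T : tensor R m.+1 n) l :
  Q_eigenvalue T l -> l <= Z_radius (realify T).
Proof.
by move/Q_eigenvalue_realify/Z_radius_ge; apply: le_trans; exact: ler_norm.
Qed.

Lemma Q_max_le m n (T : tensor R m.+1 n) : Q_max T <= Z_radius (realify T).
Proof.
have [E|/set0P ne] := eqVneq (Q_eigenvalue T) set0.
  by rewrite /Q_max E sup0 Z_radius_ge0.
by apply: ge_sup => // l; exact: Q_eigenvalue_le.
Qed.

Lemma sym_nonzero_realify m n (T : tensor R m.+1 n) :
  sym_nonzero R m.+1 n T -> sym_nonzero R m.+1 (2 * n) (realify T).
Proof.
move=> [Tsym /frobenius_gt0 T0]; split; first exact: realify_sym.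
move=> E; have := frobenius_realify T; rewrite E => /eqP; apply/negP.
rewrite lt_eqF // (_ : frobenius _ = 0).
  by rewrite mulr_gt0 // sqrtr_gt0 exprn_gt0.
by rewrite /frobenius big1 ?sqrtr0 // => t _; rewrite ffunE expr0n.
Qed.

Lemma sqrt2_exp m : Num.sqrt (2 ^+ m) = 2 `^ ((m.+1%:R - 1) / 2) :> R.
Proof.
by rewrite powRrM -[m.+1%:R]natr1 addrK powR_mulrn // powR12_sqrt // exprn_ge0.
Qed.

Lemma mu_gt0 m n : (0 < n)%N -> 0 < mu R m.+1 n.
Proof.
case: n => // n _; have [c c0 cZ] := @Z_radius_lower_bound R m n.+1 isT.
apply: lt_le_trans c0 _; apply: lb_le_inf => [|_ [T T0 <-]]; last exact: cZ.
(* A lower bound passes to the infimum only for a nonempty set; the pure tensor supplies an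
   element. *)
exists (Z_radius (pure_tensor R m.+1 n) / frobenius (pure_tensor R m.+1 n)).
by exists (pure_tensor R m.+1 n) => //; split;
  [exact: pure_tensor_sym|exact: pure_tensor_neq0].
Qed.

Lemma mu_le m n (T : tensor R m.+1 n) :
  sym_nonzero R m.+1 n T -> mu R m.+1 n <= Z_radius T / frobenius T.
Proof.
move=> T0; apply: ge_inf; last by exists T.
by exists 0 => _ [S _ <-]; rewrite divr_ge0 ?Z_radius_ge0 ?frobenius_ge0.
Qed.

Lemma Z_radius_gt0 m n (T : tensor R m.+1 n) : (0 < n)%N ->
  sym_nonzero R m.+1 n T -> 0 < Z_radius T.
Proof.
move=> n0 T0; have [_ /frobenius_gt0 F0] := T0.
by have := lt_le_trans (mu_gt0 m n0) (mu_le T0); rewrite pmulr_lgt0 ?invr_gt0.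
Qed.

Lemma le_rho m n (T : tensor R m.+1 n) :
  sym_nonzero R m.+1 n T -> Z_radius T <= rho R m.+1 n * frobenius T.
Proof.
move=> T0; have [_ /frobenius_gt0 F0] := T0.
by rewrite -ler_pdivrMr //; apply: ub_le_sup; [exact: rho_has_ubound|exists T].
Qed.

Lemma QR_ratios_ubound m n : (0 < n)%N ->
  ubound (QR_ratios R m.+1 n)
    (2 `^ ((m.+1%:R - 1) / 2) * rho R m.+1 (2 * n) / mu R m.+1 n).
Proof.
move=> n0 _ [T T0 <-]; have [_ /frobenius_gt0 F0] := T0.
have mu0 := mu_gt0 m n0; have Z0 := Z_radius_gt0 n0 T0.
have rT := sym_nonzero_realify T0; have [_ /frobenius_gt0 rF0] := rT.
(* Nonnegativity of [rho] allows ||T|| <= Z(T) / mu to be multiplied by it in the last step. *)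
have rho0 : 0 <= rho R m.+1 (2 * n).
  by rewrite -(pmulr_lge0 _ rF0) (le_trans _ (le_rho rT)) // Z_radius_ge0.
rewrite ler_pdivrMr // (le_trans (Q_max_le T)) // (le_trans (le_rho rT)) //.
rewrite frobenius_realify sqrt2_exp mulrCA mulrA -!mulrA.
rewrite ler_wpM2l ?powR_ge0 // ler_wpM2l // mulrC ler_pdivlMr //.
by rewrite mulrC -ler_pdivlMr // mu_le.
Qed.

End Ratio.

Theorem theorem4p3 (R : realType) (m n : nat) (hm : (2 <= m)%N) (hn : (2 <= n)%N) :
  [/\ has_sup (QR_ratios R m n),
      0 < QR_ratio R m n,
      1 <= QR_ratio R m n &
      QR_ratio R m n <=
        2 `^ ((m%:R - 1) / 2) * rho R m (2 * n)%N / mu R m n].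
Proof.
case: m hm => [|[|m]] // _; case: n hn => // n _.
set E := pure_tensor R m.+2 n.
have E0 : sym_nonzero R m.+2 n.+1 E.
  by split; [exact: pure_tensor_sym|exact: pure_tensor_neq0].
have QE : QR_ratios R m.+2 n.+1 (Q_max E / Z_radius E) by exists E.
have ub := @QR_ratios_ubound R m.+1 n.+1 isT.
have hs : has_sup (QR_ratios R m.+2 n.+1).
  by split; [exists (Q_max E / Z_radius E)|eexists; exact: ub].
(* The chain is Z(E) <= 1 <= Q(E). That Q(E) dominates the Q-eigenvalue 1 requires the Q-eigenvalues
   to be bounded above, which realification provides. *)
have ge1 : 1 <= QR_ratio R m.+2 n.+1.
  apply: le_trans (ub_le_sup hs.2 QE).
  rewrite ler_pdivlMr ?(Z_radius_gt0 _ E0) // mul1r.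
  apply: le_trans (Z_radius_pure_tensor R m.+1 n) _.
  apply: ub_le_sup; last exact: Q_eigenvalue_pure_tensor.
  by exists (Z_radius (realify E)) => l; exact: Q_eigenvalue_le.
split=> //; first exact: lt_le_trans ltr01 ge1.
by apply: ge_sup => //; exact: hs.1.
Qed.
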